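(* Let $\alpha > 0$ be a real number. Then $$\lim_{k\to\infty} k^{\alpha}\, \frac{(k-1)(k-2)\cdots 1}{(k-1+\alpha)(k-2+\alpha)\cdots \alpha} = \Gamma(\alpha)$$ and $$\lim_{k\to\infty} \sqrt{\pi}\, k^{\alpha}\, \frac{\left(k-\frac{1}{2}\right)\left(k-\frac{3}{2}\right)\cdots \frac{1}{2}}{\left(k-\frac{1}{2}+\alpha\right)\left(k-\frac{3}{2}+\alpha\right)\cdots\left(\frac{1}{2}+\alpha\right)} = \Gamma\left(\alpha+\frac{1}{2}\right),$$ where $k$ ranges over positive integers.
   Context: The Gamma function $\Gamma:(0,\infty)\to\mathbf{R}$ is defined by $\Gamma(\alpha)=\int_0^\infty e^{-t}t^{\alpha-1}\,dt$. In the first limit, the numerator is $\prod_{j=1}^{k-1} j$ (an empty product equals $1$) and the denominator is $\prod_{j=0}^{k-1}(j+\alpha)$. In the second limit, the numerator is $\prod_{j=0}^{k-1}\left(j+\frac12\right)$ and the denominator is $\prod_{j=0}^{k-1}\left(j+\frac12+\alpha\right)$. *)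

(* Defs.v *)
From HB Require Import structures.
From mathcomp Require Export all_boot all_order all_algebra.
From mathcomp Require Export all_classical all_reals all_analysis.
Export Order.TTheory GRing.Theory Num.Theory.
Export numFieldNormedType.Exports.

Set Implicit Arguments.
Unset Strict Implicit.
Unset Printing Implicit Defensive.

Local Open Scope classical_set_scope.
Local Open Scope ring_scope.

(* The integral is a real-valued Lebesgue integral.  It is total in [alpha]: for
   [alpha <= 0], where the integral diverges, it has a junk value, so [gamma_fun]
   is meaningful only on the positive half-line. *)
Definition gamma_fun (R : realType) (alpha : R) : R :=
  \int[@lebesgue_measure R]_(t in `]0, +oo[) (expR (- t) * t `^ (alpha - 1)).

(* Main.v *)
Require Import Defs.
From mathcomp Require Import measurable_realfun ring lra.

(** Both limits are instances of Gauss's product formula: for every x > 0,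
    g_k(x) = k^x (k-1)! / (x (x+1) ... (x+k-1)) tends to Gamma(x)
    ([cvg_gauss_seq]). The first limit is this formula at alpha. The second
    sequence equals sqrt(pi) g_k(alpha + 1/2) / g_k(1/2), which tends to
    sqrt(pi) Gamma(alpha + 1/2) / Gamma(1/2), and Gamma(1/2) = sqrt(pi) is the
    Gaussian integral after t = u^2.

    For Gauss's formula, the recurrence Gamma(x + 1) = x Gamma(x) turns the
    products into Gamma values, Gamma(k + x) / Gamma(x) for the denominator and
    Gamma(k) for the numerator. What remains is that Gamma(k + x) behaves like
    k^x Gamma(k). For 0 < x <= 1 this is squeezed out of two applications of
    Wendel's inequality Gamma(y + s) <= y^s Gamma(y), 0 <= s <= 1
    ([gamma_fun_add_le]); the result is
    Gamma(x) <= g_k(x) <= Gamma(x) (1 + x/k) ([gauss_seq_bounds]).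
    Larger x follow from smaller ones by unit steps, as
    g_k(x + 1) = g_k(x) x / (1 + x/k) ([gauss_seqS]).

    The recurrence is integration by parts on the segments [1/n, n], where
    everything is continuous, followed by monotone convergence. *)

Set Implicit Arguments.
Unset Strict Implicit.
Unset Printing Implicit Defensive.

Local Open Scope classical_set_scope.
Local Open Scope ring_scope.

(** * The integrand of the Gamma function *)

Definition gamma_integrand (R : realType) (x t : R) : R :=
  expR (- t) * t `^ (x - 1).

(** The extended-real integral makes sense before its finiteness is known; the
    recurrence [gamma_integralS] is proved for it, and finiteness for arguments
    in ]0, 1[ is then read off that recurrence. *)
Definition gamma_integral (R : realType) (x : R) : \bar R :=
  (\int[@lebesgue_measure R]_(t in `]0%R, +oo[) (gamma_integrand x t)%:E)%E.

Lemma gamma_integrand_ge0 (R : realType) (x t : R) : 0 <= gamma_integrand x t.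
Proof. by rewrite mulr_ge0 ?expR_ge0 ?powR_ge0. Qed.

Lemma gamma_integrandS (R : realType) (x t : R) : 0 < t ->
  gamma_integrand (x + 1) t = t * gamma_integrand x t.
Proof.
move=> t0; rewrite /gamma_integrand (_ : x + 1 - 1 = 1 + (x - 1)); last by ring.
rewrite (@powRD _ t 1); last by rewrite (gt_eqF t0) implybT.
by rewrite powRr1 ?(ltW t0)// mulrCA.
Qed.

Lemma measurable_gamma_integrand (R : realType) (x : R) :
  measurable_fun [set: R] (gamma_integrand x).
Proof.
apply: measurable_funM; last exact: measurable_powR.
by apply: measurableT_comp => //; exact: measurable_expR.
Qed.

Lemma derivable_continuous (R : realType) (f : R -> R) :
  (forall t, derivable f t 1) -> continuous f.
Proof. by move=> df t; apply/differentiable_continuous/derivable1_diffP/df. Qed.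

Lemma derivable_gamma_integrand (R : realType) (x t : R) : 0 < t ->
  derivable (gamma_integrand x) t 1.
Proof.
move=> t0; apply: derivableM.
  by apply: ex_derive.
by apply: derivable_powR; rewrite in_itv/= andbT.
Qed.

Lemma continuous_gamma_integrand (R : realType) (x a b : R) : 0 < a ->
  {within `[a, b], continuous (gamma_integrand x)}.
Proof.
move=> a0; apply: derivable_within_continuous => t.
rewrite in_itv/= => /andP[at_ _].
by apply: derivable_gamma_integrand; exact: lt_le_trans at_.
Qed.

(** The integrand at [x + 1] is e^-t t^x, hence a primitive of the difference of
    the two integrands that the recurrence x Gamma(x) = Gamma(x + 1) compares. *)
Lemma is_derive_gamma_integrandS (R : realType) (x t : R) : 0 < t ->
  is_derive t 1 (gamma_integrand (x + 1))
    (x * gamma_integrand x t - gamma_integrand (x + 1) t).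
Proof.
move=> t0; rewrite {1}/gamma_integrand.
have De : is_derive t 1 (fun u : R => expR (- u)) (- expR (- t)).
  by apply: is_derive_eq; rewrite /GRing.scale/= mulrN1.
have Dp := is_derive1_powR (x + 1 - 1) t0.
apply: is_derive_eq; rewrite /gamma_integrand.
rewrite [X in t `^ (X - 1)](_ : _ = x); last by ring.
rewrite /GRing.scale/=; ring.
Qed.

(** * Improper integrals on the positive half-line *)

(** The segments [1/c_n, c_n] stay away from both improper ends, so that the
    fundamental theorem and the substitution rule for continuous functions on
    compact intervals apply there; monotone convergence then passes to the limit.
    The sequence is left free because the substitution t = u^2 turns the segment
    of c into the one of c^2. *)
Lemma cvg_integral_exhaust_itv0y (R : realType) (f : R -> R) (c : R^nat) :
  (forall t, 0 < t -> 0 <= f t) -> measurable_fun (`]0, +oo[ : set R) f ->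
  {homo c : m n / (m <= n)%N >-> m <= n} -> (forall n, 0 < c n) ->
  c n @[n --> \oo] --> +oo ->
  (\int[@lebesgue_measure R]_(t in `[(c n)^-1%R, c n]) (f t)%:E)%E @[n --> \oo]
    --> (\int[@lebesgue_measure R]_(t in `]0%R, +oo[) (f t)%:E)%E.
Proof.
move=> f0 mf ndc c0 cy.
have cS n : `[(c n)^-1, c n] `<=` `]0, +oo[.
  move=> t /=; rewrite !in_itv/= andbT => /andP[+ _].
  by apply: lt_le_trans; rewrite invr_gt0.
rewrite (_ : `]0, +oo[%classic = \bigcup_n `[(c n)^-1, c n]%classic); last first.
  apply/seteqP; split => [t|t [n _]]; last exact: cS.
  rewrite /= in_itv/= andbT => t0.
  have := (cvgryPge _).1 cy (Num.max t t^-1) => -[n _ /(_ n (leqnn n))] /=.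
  rewrite ge_max => /andP[tc tc']; exists n => //=.
  by rewrite in_itv/= tc andbT -[leRHS]invrK lef_pV2 ?posrE ?invr_gt0.
apply: ge0_nondecreasing_set_cvg_integral => //.
- move=> m n mn; rewrite subsetEset => t /=; rewrite !in_itv/= => /andP[ct tc].
  rewrite (le_trans tc (ndc _ _ mn)) andbT (le_trans _ ct)//.
  by rewrite lef_pV2 ?posrE ?ndc.
- move=> n; apply/measurable_EFinP; apply: measurable_funS mf => //.
- by move=> n t /cS /=; rewrite in_itv/= andbT lee_fin => /f0.
Qed.

(** One term of the exponential series, t^(N+1) / (N+1)! with N above [x - 1],
    already beats the power of t by a factor t. *)
Lemma cvgr_gamma_integrand0 (R : realType) (x : R) :
  gamma_integrand x t @[t --> +oo] --> 0.
Proof.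
pose N := (Num.truncn `|x|).+1.
have xN : x - 1 <= N%:R.
  have : `|x| < N%:R by rewrite /N truncnS_gt.
  have := ler_norm x; lra.
have F0 : 0 < (N.+1)`!%:R :> R by rewrite ltr0n fact_gt0.
apply/cvgrPdist_le => e e0; near=> t.
have t1 : 1 <= t by near: t; apply: nbhs_pinfty_ge; exact: num_real.
have te : (N.+1)`!%:R / e <= t.
  by near: t; apply: nbhs_pinfty_ge; exact: num_real.
have t0 : 0 < t by exact: lt_le_trans t1.
rewrite sub0r normrN ger0_norm ?gamma_integrand_ge0// /gamma_integrand expRN.
rewrite mulrC ler_pdivrMr ?expR_gt0//.
apply: (le_trans (ler_powR t1 xN)); rewrite powR_mulrn ?(ltW t0)//.
have := expR_ge1Dxn N (ltW t0) => h.
apply: (@le_trans _ _ (e * (t ^+ N.+1 / (N.+1)`!%:R))); last first.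
  rewrite ler_pM2l//; apply: le_trans h; by rewrite lerDr.
rewrite exprS (_ : e * _ = (t / ((N.+1)`!%:R / e)) * t ^+ N); last first.
  by field; rewrite !gt_eqF.
rewrite ler_peMl ?exprn_ge0 ?(ltW t0)// ler_pdivlMr ?mul1r// divr_gt0//.
Unshelve. all: end_near. Qed.

(** Concavity of y^s, in its tangent form at y = 1. Two uses of ln z <= z - 1, at
    z = y / u and at z = 1 / u where u is the right-hand side, combine with
    weights s and 1 - s to give s ln y <= ln u. *)
Lemma powR_le_tangent (R : realType) (y s : R) : 0 < y -> 0 <= s <= 1 ->
  y `^ s <= 1 - s + s * y.
Proof.
move=> y0 /andP[s0 s1].
set u := 1 - s + s * y.
have u0 : 0 < u by rewrite /u; nra.
have lnle (z : R) : 0 < z -> ln z <= z - 1.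
  by move=> z0; have := @le_ln1Dx R (z - 1); rewrite subrKC; apply; lra.
have h1 : ln y - ln u <= y / u - 1.
  by rewrite -ln_div ?posrE// lnle// divr_gt0.
have h2 : - ln u <= u^-1 - 1 by rewrite -lnV ?posrE// lnle// invr_gt0.
rewrite /powR gt_eqF// -[leRHS]lnK ?posrE// ler_expR.
(* u is chosen so that the weighted tangent bounds cancel. *)
have h3 : s * (y / u - 1) + (1 - s) * (u^-1 - 1) = 0.
  have E (w : R) :
      s * (y * w - 1) + (1 - s) * (w - 1) = (1 - s + s * y) * w - 1.
    by ring.
  by rewrite E -/u divff ?subrr// gt_eqF.
nra.
Qed.

Lemma cvg_gamma_integral (R : realType) (x : R) (c : R^nat) :
  {homo c : m n / (m <= n)%N >-> m <= n} -> (forall n, 0 < c n) ->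
  c n @[n --> \oo] --> +oo ->
  (\int[@lebesgue_measure R]_(t in `[(c n)^-1%R, c n])
    (gamma_integrand x t)%:E)%E @[n --> \oo] --> gamma_integral x.
Proof.
move=> ndc c0 cy; apply: cvg_integral_exhaust_itv0y => //.
- by move=> t _; exact: gamma_integrand_ge0.
- by apply: measurable_funTS; exact: measurable_gamma_integrand.
Qed.

Lemma ler_natr2 (R : realType) :
  {homo (fun n => n.+2%:R : R) : m n / (m <= n)%N >-> m <= n}.
Proof. by move=> m n mn; rewrite ler_nat. Qed.

Lemma cvgr_natr2 (R : realType) : (n.+2%:R : R) @[n --> \oo] --> +oo.
Proof.
apply/cvgryPge => A.
have /cvgryPge/(_ A)[N _ AN] := @cvgr_idn R.
by exists N => // n Nn; apply: AN => /=; rewrite !leqW.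
Qed.

(** * The recurrence and the two special values *)

Lemma gamma_integralS_segment (R : realType) (x a b : R) : 0 < a -> a < b ->
  (\int[@lebesgue_measure R]_(t in `[a, b]) (gamma_integrand (x + 1) t)%:E
   + (gamma_integrand (x + 1) b - gamma_integrand (x + 1) a)%:E
   = x%:E * \int[@lebesgue_measure R]_(t in `[a, b]) (gamma_integrand x t)%:E)%E.
Proof.
move=> a0 ab.
have cg y := @continuous_gamma_integrand R y a b a0.
have ig y : lebesgue_measure.-integrable `[a, b] (EFin \o gamma_integrand y).
  by apply: continuous_compact_integrable; [exact: segment_compact|exact: cg].
have izg : lebesgue_measure.-integrable `[a, b]
    (fun t => x%:E * (gamma_integrand x t)%:E)%E.
  exact: integrableZl (ig x).
have cF : derivable_oo_LRcontinuous (gamma_integrand (x + 1)) a b.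
  split.
  - move=> t; rewrite in_itv/= => /andP[at_ _].
    by apply: derivable_gamma_integrand; exact: lt_trans at_.
  - apply: cvg_at_right_filter; apply/differentiable_continuous/derivable1_diffP.
    exact: derivable_gamma_integrand.
  - apply: cvg_at_left_filter; apply/differentiable_continuous/derivable1_diffP.
    by apply: derivable_gamma_integrand; exact: lt_trans ab.
have := @continuous_FTC2 R
  (fun t => x * gamma_integrand x t - gamma_integrand (x + 1) t) _ a b ab _ cF.
rewrite EFinB => <-; last 2 first.
- move=> t; apply: cvgB; last exact: cg.
  by apply: cvgM; [exact: cvg_cst|exact: cg].
- move=> t; rewrite in_itv/= => /andP[at_ _]; rewrite derive1E.
  by have [_ ->] := is_derive_gamma_integrandS x (lt_trans a0 at_).
under [X in (_ + X)%E]eq_integral do rewrite EFinB EFinM.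
pose A (y : R) : \bar R :=
  (\int[@lebesgue_measure R]_(t in `[a, b]) (gamma_integrand y t)%:E)%E.
rewrite [X in (_ + X)%E](_ : _ = x%:E * A x - A (x + 1)%R)%E; last first.
  etransitivity; first exact: (integralB _ izg (ig (x + 1))).
  by congr (_ - _)%E; exact: (integralZl _ (ig x)).
by rewrite addeC subeK//; exact: (integrable_fin_num _ (ig (x + 1))).
Qed.

(** Valid in the extended reals, the value +oo not being excluded yet: on the
    segments the boundary terms tend to 0, at 0 because t^x does and at +oo
    because of the exponential. *)
Lemma gamma_integralS (R : realType) (x : R) : 0 < x ->
  gamma_integral (x + 1) = (x%:E * gamma_integral x)%E.
Proof.
move=> x0; pose c n : R := n.+2%:R.
have c0 n : 0 < c n by rewrite ltr0n.
have cy := @cvgr_natr2 R.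
pose b n := gamma_integrand (x + 1) (c n) - gamma_integrand (x + 1) (c n)^-1.
have b0 : b n @[n --> \oo] --> 0.
  rewrite -[0]subr0; apply: cvgB.
    exact: cvg_comp cy (@cvgr_gamma_integrand0 R (x + 1)).
  have cV : (c n)^-1 `^ x @[n --> \oo] --> 0.
    apply: (@cvg_comp _ _ _ (fun n => (c n)^-1) (fun t => t `^ x) _ (0^'+)).
      move=> A [e /= e0 eA].
      have /cvgrPdist_lt/(_ e e0) : (c n)^-1 @[n --> \oo] --> 0.
        by apply/gtr0_cvgV0 => //; exact: nearW.
      by apply: filterS => n ne; apply: eA; rewrite ?invr_gt0.
    exact: powR_cvg0.
  apply: squeeze_cvgr cV; last exact: cvg_cst.
  near=> n; rewrite gamma_integrand_ge0/= /gamma_integrand addrK.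
  by rewrite ler_piMl ?powR_ge0// -expR0 ler_expR oppr_le0 invr_ge0 ltW.
have Il := @cvg_gamma_integral R (x + 1) c (@ler_natr2 R) c0 cy.
have Ir := @cvg_gamma_integral R x c (@ler_natr2 R) c0 cy.
have L : (\int[@lebesgue_measure R]_(t in `[(c n)^-1%R, c n])
      (gamma_integrand (x + 1) t)%:E + (b n)%:E)%E @[n --> \oo]
    --> (gamma_integral (x + 1) + 0)%E.
  apply: cvgeD => //; first exact: fin_num_adde_defl.
  by apply: cvg_EFin b0; exact: nearW.
rewrite adde0 in L.
apply: (cvg_unique _ L) => //.
have -> : (fun n => \int[@lebesgue_measure R]_(t in `[(c n)^-1%R, c n])
      (gamma_integrand (x + 1) t)%:E + (b n)%:E)%E
  = (fun n => x%:E * \int[@lebesgue_measure R]_(t in `[(c n)^-1%R, c n])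
      (gamma_integrand x t)%:E)%E.
  apply/funext => n; apply: gamma_integralS_segment; rewrite ?invr_gt0//.
  have c1 : 1 < c n by rewrite ltr1n.
  by rewrite (lt_trans _ c1)// invf_lt1.
exact: cvgeZl.
Unshelve. all: end_near. Qed.

Lemma gamma_integral1 (R : realType) : gamma_integral (1 : R) = 1%E.
Proof.
rewrite /gamma_integral integral_itv_obnd_cbnd; last first.
  apply/measurable_EFinP/measurable_funTS; exact: measurable_gamma_integrand.
have E t : gamma_integrand (1 : R) t = expR (- t).
  by rewrite /gamma_integrand subrr powRr0 mulr1.
under eq_integral do rewrite E.
have De (t : R) : is_derive t 1 (fun u : R => - expR (- u)) (expR (- t)).
  by apply: is_derive_eq; rewrite /GRing.scale/= mulrN1 opprK.
rewrite (@ge0_continuous_FTC2y _ _ (fun u => - expR (- u)) 0 0).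
- by rewrite oppr0 expR0 -EFinB sub0r opprK.
- by move=> t _; exact: expR_ge0.
- apply: continuous_subspaceT; apply: derivable_continuous => t.
  by apply: ex_derive.
- by rewrite -oppr0; apply: cvgN; exact: cvgr_expR.
- by move=> t _; apply: ex_derive.
- apply: cvg_at_right_filter.
  apply: (derivable_continuous (f := fun u => - expR (- u))) => t.
  by apply: ex_derive.
- by move=> t _; rewrite derive1E; have [_ ->] := De t.
Qed.

(** With t = u^2 the integral becomes twice the Gaussian integral on the
    half-line. *)
Lemma gamma_integral_half (R : realType) :
  gamma_integral (2^-1 : R) = (Num.sqrt pi)%:E.
Proof.
pose c n : R := n.+2%:R.
have c0 n : 0 < c n by rewrite ltr0n.
have c1 n : 1 < c n by rewrite ltr1n.
have cy := @cvgr_natr2 R.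
have c2_0 n : 0 < c n ^+ 2 by rewrite exprn_gt0.
have ndc2 : {homo (fun n => c n ^+ 2) : m n / (m <= n)%N >-> m <= n}.
  by move=> m n mn; rewrite lerXn2r ?nnegrE ?(ltW (c0 _)) ?ler_nat.
have c2y : c n ^+ 2 @[n --> \oo] --> +oo.
  apply/cvgryPge => A; move/cvgryPge : cy => /(_ A).
  apply: filterS => n /le_trans; apply.
  by rewrite expr2 ler_peMl ?(ltW (c0 n)) ?(ltW (c1 n)).
have L := @cvg_gamma_integral R 2^-1 _ ndc2 c2_0 c2y.
have M := @cvg_integral_exhaust_itv0y R (fun t => 2 * gauss_fun t) c.
have mg : measurable_fun (`]0, +oo[ : set R) (fun t => 2 * gauss_fun t).
  apply: measurable_funTS; apply: measurable_funM => //.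
  exact: measurable_gauss_fun.
have {}M := M (fun t _ => mulr_ge0 (ler0n R 2) (gauss_fun_ge0 t)) mg
  (@ler_natr2 R) c0 cy.
have -> : (Num.sqrt pi)%:E =
    (\int[@lebesgue_measure R]_(t in `]0%R, +oo[) (2 * gauss_fun t)%:E)%E.
  rewrite integral_itv_obnd_cbnd; last exact/measurable_EFinP.
  under eq_integral do rewrite EFinM.
  rewrite ge0_integralZl_EFin//.
  - by rewrite integral0y_gauss -EFinM mulrC divfK.
  - by move=> t _; rewrite lee_fin gauss_fun_ge0.
  - by apply/measurable_EFinP/measurable_funTS; exact: measurable_gauss_fun.
apply: (cvg_unique _ L) => //.
apply: cvg_trans M; apply: near_eq_cvg; apply: nearW => n.
have ab : (c n)^-1 < c n by rewrite (lt_trans _ (c1 n))// invf_lt1.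
have a0 : 0 < (c n)^-1 by rewrite invr_gt0.
have D (u : R) : is_derive u 1 (fun u : R => u ^+ 2) (2 * u).
  apply: is_derive_eq; rewrite /GRing.scale/=; ring.
have D' : (fun u : R => u ^+ 2)^`()%classic = (fun u => 2 * u).
  by apply/funext => u; rewrite derive1E; have [_ ->] := D u.
have C2 : continuous (fun u : R => 2 * u).
  by apply: derivable_continuous => t; apply: ex_derive.
have CF : continuous (fun u : R => u ^+ 2).
  by apply: derivable_continuous => t; apply: ex_derive.
rewrite -exprVn (@integration_by_substitution_increasing R (fun u => u ^+ 2)
  (gamma_integrand 2^-1) (c n)^-1 (c n)) ?(ltW ab)//.
- apply: eq_integral => u; rewrite inE/= in_itv/= => /andP[au _].
  have u0 : 0 < u := lt_le_trans a0 au.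
  rewrite D' fctE /= /gamma_integrand /gauss_fun.
  rewrite -(@powR_mulrn _ u 2) ?(ltW u0)// -powRrM.
  rewrite (_ : 2%:R * (2^-1 - 1) = -1); last by field.
  rewrite powR_inv1 ?(ltW u0)// powR_mulrn ?(ltW u0)//.
  by congr EFin; field; rewrite gt_eqF.
- move=> u v; rewrite !in_itv/= => /andP[au _] /andP[av _] uv.
  by rewrite ltrXn2r ?nnegrE// ltW// (lt_le_trans a0).
- by rewrite D' => u _; exact: C2.
- rewrite D'; apply/cvg_ex; exists (2 * (c n)^-1).
  by apply: cvg_at_right_filter; exact: C2.
- rewrite D'; apply/cvg_ex; exists (2 * c n).
  by apply: cvg_at_left_filter; exact: C2.
- split.
  + by move=> u _; apply: ex_derive.
  + by apply: cvg_at_right_filter; exact: CF.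
  + by apply: cvg_at_left_filter; exact: CF.
- by apply: continuous_gamma_integrand; rewrite exprn_gt0.
Qed.

(** * Finiteness, and the properties of the real-valued Gamma function *)

Lemma gamma_integral_ge0 (R : realType) (x : R) : (0 <= gamma_integral x)%E.
Proof.
by apply: integral_ge0 => t _; rewrite lee_fin; exact: gamma_integrand_ge0.
Qed.

(** At positive integers this follows from the recurrence. For y >= 1 the power
    t^(y-1) is at most 1 + t^n with n >= y - 1, which bounds the integral by the
    sum of two integer ones. Finally x * I(x) = I(x + 1) with x + 1 >= 1
    covers all x > 0. *)
Lemma gamma_integral_fin_num (R : realType) (x : R) : 0 < x ->
  gamma_integral x \is a fin_num.
Proof.
have natP n : gamma_integral (n.+1%:R : R) \is a fin_num.
  elim: n => [|n IH]; first by rewrite gamma_integral1.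
  by rewrite -natr1 gamma_integralS ?ltr0n// fin_numM.
have mI (y : R) :
    measurable_fun (`]0, +oo[ : set R) (EFin \o gamma_integrand y).
  by apply/measurable_EFinP/measurable_funTS; exact: measurable_gamma_integrand.
have ge1P (y : R) : 1 <= y -> gamma_integral y \is a fin_num.
  move=> y1; pose n := Num.truncn y.
  have yn : y <= n.+1%:R by rewrite ltW// truncnS_gt.
  rewrite ge0_fin_numE ?gamma_integral_ge0//.
  pose bound := (gamma_integral (1 : R) + gamma_integral n.+1%:R%R)%E.
  apply: (@le_lt_trans _ _ bound); last first.
    rewrite /bound gamma_integral1; apply: lte_add_pinfty; first exact: ltry.
    by rewrite -ge0_fin_numE ?gamma_integral_ge0.
  rewrite /bound -ge0_integralD//; first last.
  - exact: mI.
  - by move=> t _; rewrite lee_fin gamma_integrand_ge0.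
  - exact: mI.
  - by move=> t _; rewrite lee_fin gamma_integrand_ge0.
  apply: ge0_le_integral => //.
  - by move=> t _; rewrite lee_fin gamma_integrand_ge0.
  - exact: mI.
  - by apply: emeasurable_funD; exact: mI.
  move=> t /=; rewrite in_itv/= andbT => t0; rewrite -EFinD lee_fin.
  rewrite /gamma_integrand -mulrDr ler_pM2l ?expR_gt0// subrr powRr0.
  have [t1|t1] := leP t 1.
    rewrite (@le_trans _ _ 1)// ?lerDl ?powR_ge0//.
    by rewrite -[leRHS](powRr0 t) ger_powR ?t0// subr_ge0.
  by rewrite (le_trans (ler_powR (ltW t1) (lerB yn (lexx 1))))// lerDr.
move=> x0; have : gamma_integral (x + 1) \is a fin_num.
  by apply: ge1P; rewrite lerDr ltW.
rewrite gamma_integralS// !ge0_fin_numE; last 2 first.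
- exact: gamma_integral_ge0.
- by rewrite mule_ge0 ?lee_fin ?(ltW x0)// gamma_integral_ge0.
case: (gamma_integral x) => [r _||//]; first exact: ltry.
by rewrite gt0_muley ?lte_fin.
Qed.

Lemma integrable_gamma_integrand (R : realType) (x : R) : 0 < x ->
  (@lebesgue_measure R).-integrable `]0, +oo[ (EFin \o gamma_integrand x).
Proof.
move=> x0; apply/integrableP; split.
  by apply/measurable_EFinP/measurable_funTS; exact: measurable_gamma_integrand.
have := gamma_integral_fin_num x0.
rewrite /gamma_integral -integral_fin_num_abs//.
by apply: measurable_funTS; exact: measurable_gamma_integrand.
Qed.

Lemma gamma_funS (R : realType) (x : R) : 0 < x ->
  gamma_fun (x + 1) = x * gamma_fun x.
Proof.
move=> x0; rewrite /gamma_fun /Rintegral -/(gamma_integral (x + 1)).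
by rewrite gamma_integralS// fineM// gamma_integral_fin_num.
Qed.

Lemma gamma_fun1 (R : realType) : gamma_fun (1 : R) = 1.
Proof. by rewrite /gamma_fun /Rintegral -/(gamma_integral 1) gamma_integral1. Qed.

Lemma gamma_fun_half (R : realType) : gamma_fun (2^-1 : R) = Num.sqrt pi.
Proof.
by rewrite /gamma_fun /Rintegral -/(gamma_integral 2^-1) gamma_integral_half.
Qed.

(** Wendel's inequality. Usually deduced from Hoelder's inequality, it also comes
    from integrating a pointwise bound: (t/x)^s <= 1 - s + s t/x, and the
    right-hand side integrates against e^-t t^(x-1) to exactly Gamma(x), since
    Gamma(x + 1) / x = Gamma(x). *)
Lemma gamma_fun_add_le (R : realType) (x s : R) : 0 < x -> 0 <= s <= 1 ->
  gamma_fun (x + s) <= x `^ s * gamma_fun x.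
Proof.
move=> x0 s01; have /andP[s0 s1] := s01.
have xs0 : 0 < x + s by rewrite ltr_wpDr.
have x10 : 0 < x + 1 by rewrite ltr_wpDr.
have I1 := integrable_gamma_integrand x0.
have I2 := integrable_gamma_integrand x10.
have -> : x `^ s * gamma_fun x = \int[@lebesgue_measure R]_(t in `]0, +oo[)
   (x `^ s * (1 - s) * gamma_integrand x t
    + x `^ s * (s / x) * gamma_integrand (x + 1) t).
  rewrite RintegralD//; last 2 first.
  - exact: (integrableZl _ _ I1).
  - exact: (integrableZl _ _ I2).
  rewrite !RintegralZl// -/(gamma_fun x) -/(gamma_fun (x + 1)) gamma_funS//.
  by field; rewrite gt_eqF.
apply: le_Rintegral => //.
- exact: integrable_gamma_integrand.
- exact: (integrableD _ (integrableZl _ _ I1) (integrableZl _ _ I2)).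
move=> t /=; rewrite in_itv/= andbT => t0.
rewrite gamma_integrandS//.
have -> : expR (- t) * t `^ (x + s - 1) = t `^ s * gamma_integrand x t.
  rewrite (_ : x + s - 1 = s + (x - 1)); last by ring.
  by rewrite (@powRD _ t s) ?(gt_eqF t0) ?implybT// mulrCA.
rewrite mulrA -mulrDl ler_wpM2r ?gamma_integrand_ge0//.
have -> : t `^ s = x `^ s * (t / x) `^ s.
  by rewrite -powRM ?(ltW x0) ?divr_ge0 ?ltW// mulrC divfK// gt_eqF.
rewrite -!mulrA -mulrDr ler_pM2l ?powR_gt0// (mulrC x^-1).
by apply: powR_le_tangent => //; rewrite divr_gt0.
Qed.

Lemma gamma_fun_addn (R : realType) (x : R) (k : nat) : 0 < x ->
  gamma_fun (k%:R + x) = gamma_fun x * \prod_(0 <= j < k) (j%:R + x).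
Proof.
move=> x0; elim: k => [|k IH]; first by rewrite add0r big_geq// mulr1.
rewrite big_nat_recr//= mulrA -IH -natr1 addrAC gamma_funS.
  by rewrite mulrC.
by rewrite ltr_wpDl.
Qed.

Lemma gamma_fun_nat (R : realType) (k : nat) :
  gamma_fun (k.+1%:R : R) = \prod_(1 <= j < k.+1) j%:R.
Proof.
rewrite -natr1 gamma_fun_addn// gamma_fun1 mul1r big_add1/=.
by apply: eq_bigr => j _; rewrite natr1.
Qed.

(** * Gauss's product *)

Definition gauss_seq (R : realType) (x : R) (k : nat) : R :=
  k%:R `^ x *
  ((\prod_(1 <= j < k) (j%:R : R)) / (\prod_(0 <= j < k) (j%:R + x))).

Lemma prod_shift_gt0 (R : realType) (x : R) (k : nat) : 0 < x ->
  0 < \prod_(0 <= j < k) (j%:R + x).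
Proof. by move=> x0; apply: prodr_gt0 => j _; rewrite ltr_wpDl. Qed.

(** With c = k + 1 and P the denominator, Gamma(x) = Gamma(c + x) / P and the
    Gauss term is c^x Gamma(c) / P, so both bounds compare Gamma(c + x) with
    c^x Gamma(c). Wendel's inequality at c with exponent x gives the lower one.
    At c + x with exponent 1 - x it bounds Gamma(c + 1) = c Gamma(c), which
    gives the upper one with factor (1 + x/c)^(1 - x) <= 1 + x/c. *)
Lemma gauss_seq_bounds (R : realType) (x : R) (k : nat) : 0 < x <= 1 ->
  gamma_fun x <= gauss_seq x k.+1 <= gamma_fun x * (1 + x / k.+1%:R).
Proof.
move=> /andP[x0 x1]; rewrite /gauss_seq -gamma_fun_nat.
set c : R := k.+1%:R; set P := \prod_(0 <= j < k.+1) _.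
have c0 : 0 < c by rewrite ltr0n.
have P0 : 0 < P := prod_shift_gt0 k.+1 x0.
have GP : gamma_fun x = gamma_fun (c + x) / P.
  by rewrite gamma_fun_addn// mulfK// gt_eqF.
have cx0 : 0 < c + x by rewrite addr_gt0.
apply/andP; split.
  by rewrite GP mulrA ler_pM2r ?invr_gt0// gamma_fun_add_le// (ltW x0).
have /(_ (1 - x)) h := gamma_fun_add_le cx0.
have {}h : c * gamma_fun c <= (c + x) `^ (1 - x) * gamma_fun (c + x).
  rewrite -gamma_funS// (_ : c + 1 = c + x + (1 - x)); last by ring.
  by apply: h; rewrite subr_ge0 x1/= gerBl ltW.
have cE : c `^ x * gamma_fun c = c `^ (x - 1) * (c * gamma_fun c).
  by rewrite mulrA [c `^ (x - 1) * c]mulrC mulr_powRB1// ltW.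
rewrite mulrA cE GP [leRHS]mulrAC ler_pM2r ?invr_gt0//.
apply: (@le_trans _ _
  (c `^ (x - 1) * ((c + x) `^ (1 - x) * gamma_fun (c + x)))).
  by rewrite ler_pM2l ?powR_gt0.
have G0 : 0 <= gamma_fun (c + x).
  by apply: Rintegral_ge0 => t _; exact: gamma_integrand_ge0.
rewrite mulrA [leRHS]mulrC ler_wpM2r//.
have -> : c `^ (x - 1) * (c + x) `^ (1 - x) = (1 + x / c) `^ (1 - x).
  rewrite (_ : 1 + x / c = c^-1 * (c + x)); last by field; rewrite gt_eqF.
  rewrite powRM ?invr_ge0 ?(ltW c0) ?(ltW cx0)//.
  rewrite -(powR_inv1 (ltW c0)) -powRrM (_ : -1 * (1 - x) = x - 1)//; ring.
by rewrite ler1_powR ?lerDl ?divr_ge0 ?(ltW x0) ?(ltW c0)// gerBl ltW.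
Qed.

Lemma cvg_divr_nat (R : realType) (x : R) : (x / n.+1%:R) @[n --> \oo] --> 0.
Proof.
rewrite -[0](mulr0 x); apply: cvgM; first exact: cvg_cst.
exact: cvg_harmonic.
Qed.

(** The products at [x] and [x + 1] differ by their end factors only. The extra
    factor tends to x, so convergence at [x] yields convergence at [x + 1]. *)
Lemma gauss_seqS (R : realType) (x : R) (k : nat) : 0 < x ->
  gauss_seq (x + 1) k.+1 = gauss_seq x k.+1 * (x / (1 + x / k.+1%:R)).
Proof.
move=> x0; rewrite /gauss_seq; set N := \prod_(1 <= j < k.+1) _.
set c : R := k.+1%:R; have c0 : 0 < c by rewrite ltr0n.
have cx0 : 0 < c + x by rewrite addr_gt0.
have PE : x * \prod_(0 <= j < k.+1) (j%:R + (x + 1))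
    = \prod_(0 <= j < k.+1) (j%:R + x) * (c + x).
  rewrite -(@big_nat_recr _ _ _ k.+1 0 (fun j => j%:R + x))//.
  rewrite [RHS]big_nat_recl// add0r; congr (_ * _).
  by apply: eq_bigr => j _; rewrite -natr1; ring.
have Q0 := prod_shift_gt0 k.+1 x0.
have P0 := prod_shift_gt0 k.+1 (addr_gt0 x0 ltr01).
move: PE Q0 P0; set P := \prod_(0 <= j < _) (_ + (_ + _)).
set Q := \prod_(0 <= j < _) _.
move=> PE Q0 P0.
rewrite powRD ?(gt_eqF c0) ?implybT// powRr1 ?(ltW c0)//.
have -> : P = Q * (c + x) / x by rewrite -PE mulrC mulKf// gt_eqF.
by field; rewrite nat1r !gt_eqF.
Qed.

Lemma cvg_gauss_seq_le1 (R : realType) (x : R) : 0 < x <= 1 ->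
  gauss_seq x k @[k --> \oo] --> gamma_fun x.
Proof.
move=> x01; rewrite -cvg_shiftS.
apply: (@squeeze_cvgr _ _ _ _ (fun=> gamma_fun x)
  (fun k => gamma_fun x * (1 + x / k.+1%:R))).
- by apply: nearW => k; exact: gauss_seq_bounds.
- exact: cvg_cst.
- rewrite -[X in _ --> X]mulr1; apply: cvgM; first exact: cvg_cst.
  rewrite -[X in _ --> X]addr0; apply: cvgD; first exact: cvg_cst.
  exact: cvg_divr_nat.
Qed.

(** Induction on the number of unit steps that bring x into ]0, 1]. *)
Lemma cvg_gauss_seq (R : realType) (x : R) : 0 < x ->
  gauss_seq x k @[k --> \oo] --> gamma_fun x.
Proof.
have [m xm] : exists m, x <= m.+1%:R.
  by exists (Num.truncn x); rewrite ltW// truncnS_gt.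
elim: m x xm => [|m IH] x xm x0; first by apply: cvg_gauss_seq_le1; rewrite x0.
have [x1|x1] := leP x 1; first by apply: cvg_gauss_seq_le1; rewrite x0.
have y0 : 0 < x - 1 by rewrite subr_gt0.
have {}IH : gauss_seq (x - 1) k @[k --> \oo] --> gamma_fun (x - 1).
  by apply: IH => //; rewrite lerBlDr natr1.
rewrite -(subrK 1 x) gamma_funS// -cvg_shiftS mulrC.
rewrite (_ : (fun k => _) = (fun k => gauss_seq (x - 1) k.+1 *
    ((x - 1) / (1 + (x - 1) / k.+1%:R)))); last first.
  by apply/funext => k; rewrite gauss_seqS.
apply: cvgM; first by rewrite cvg_shiftS.
rewrite -[X in _ --> X]mulr1; apply: cvgM; first exact: cvg_cst.
rewrite -[X in _ --> X]invr1; apply: cvgV; first exact: oner_neq0.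
rewrite -[X in _ --> X]addr0; apply: cvgD; first exact: cvg_cst.
exact: cvg_divr_nat.
Qed.

(** The second sequence is sqrt(pi) times the quotient of the Gauss terms at
    alpha + 1/2 and at 1/2, and the latter tend to Gamma(1/2) = sqrt(pi). *)
Theorem theorem1 (R : realType) (alpha : R) (alpha_gt0 : 0 < alpha) :
  ((fun k : nat =>
      k%:R `^ alpha *
      ((\prod_(1 <= j < k) (j%:R : R)) / (\prod_(0 <= j < k) (j%:R + alpha))))
     @ \oo --> gamma_fun alpha)
  /\
  ((fun k : nat =>
      Num.sqrt pi * k%:R `^ alpha *
      ((\prod_(0 <= j < k) (j%:R + 2^-1 : R)) /
       (\prod_(0 <= j < k) (j%:R + 2^-1 + alpha))))
     @ \oo --> gamma_fun (alpha + 2^-1)).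
Proof.
split; first exact: cvg_gauss_seq.
have h0 : 0 < 2^-1 :> R by rewrite invr_gt0.
have ah0 : 0 < alpha + 2^-1 by rewrite addr_gt0.
have spi0 : Num.sqrt pi != 0 :> R by rewrite gt_eqF// sqrtr_gt0 pi_gt0.
have Lh : gauss_seq (2^-1 : R) k.+1 @[k --> \oo] --> Num.sqrt (pi : R).
  by rewrite cvg_shiftS -gamma_fun_half; exact: cvg_gauss_seq.
have La : gauss_seq (alpha + 2^-1) k.+1 @[k --> \oo] -->
    gamma_fun (alpha + 2^-1).
  by rewrite cvg_shiftS; exact: cvg_gauss_seq.
(* At k + 1 every factor is positive, so the Gauss terms can be cancelled. *)
rewrite -cvg_shiftS -[gamma_fun _](mulKf spi0) mulrCA.
rewrite (_ : (fun k => _) = (fun k => Num.sqrt pi *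
    ((gauss_seq (2^-1 : R) k.+1)^-1 * gauss_seq (alpha + 2^-1) k.+1))).
  by apply: cvgM; [exact: cvg_cst|apply: cvgM => //; exact: cvgV].
apply/funext => k; rewrite /gauss_seq.
set c : R := k.+1%:R; have c0 : 0 < c by rewrite ltr0n.
have P0 := prod_shift_gt0 k.+1 h0.
have Q0 := prod_shift_gt0 k.+1 ah0.
have N0 : 0 < \prod_(1 <= j < k.+1) (j%:R : R).
  by rewrite big_add1/= prodr_gt0// => j _; rewrite ltr0n.
have PQ : \prod_(0 <= j < k.+1) (j%:R + 2^-1 + alpha) =
    \prod_(0 <= j < k.+1) (j%:R + (alpha + 2^-1)).
  by apply: eq_bigr => j _; rewrite -addrA (addrC alpha).
rewrite PQ powRD ?(gt_eqF c0) ?implybT//.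
have ch : c `^ 2^-1 != 0 by rewrite gt_eqF// powR_gt0.
move: PQ P0 Q0 N0 => _; set P := \prod_(0 <= j < k.+1) (_ + 2^-1).
set Q := \prod_(0 <= j < k.+1) _; set N := \prod_(1 <= j < k.+1) _.
by move=> P0 Q0 N0; field; rewrite ch !gt_eqF.
Qed.
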